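(* For any $\mathcal{S}_d$-valued random matrix $Y$ and any $t \in \mathbb{R}$, $$\mathbb{P}\left\{\lambda_{\min }(Y) \geq t\right\} \leq \frac{1}{d} \inf _{\theta>0}\left\{e^{-\theta t} \cdot \mathbb{E} \operatorname{tr} (e^{\theta Y})\right\}.$$
   Context: $\mathcal{S}_d$ denotes the set of $d\times d$ real symmetric matrices. $\lambda_{\min}(Y)$ is the smallest eigenvalue of $Y$. The matrix exponential of a symmetric matrix is obtained by applying the exponential to its eigenvalues in an orthogonal diagonalization. *)

(* Defs.v *)
From HB Require Import structures.
From mathcomp Require Import all_boot all_order all_algebra.
From mathcomp Require Import all_classical all_reals all_analysis.

Set Implicit Arguments.
Unset Strict Implicit.
Unset Printing Implicit Defensive.

Import Order.TTheory GRing.Theory Num.Theory.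

Local Open Scope classical_set_scope.
Local Open Scope ring_scope.

(* For a symmetric A with 0 < n a least eigenvalue exists by the spectral
   theorem; 0 is a junk value for matrices without real eigenvalues. *)
Definition lambda_min (R : realType) (n : nat) (A : 'M[R]_n) : R :=
  xget 0 [set a | eigenvalue A a /\ forall b, eigenvalue A b -> a <= b].

Definition orthogonal_diagonalization (R : realType) (n : nat)
    (A U : 'M[R]_n) (l : 'rV[R]_n) : Prop :=
  U *m U^T = 1%:M /\ A = U *m diag_mx l *m U^T.

(* The result does not depend on the orthogonal diagonalization that is
   chosen; 0 is a junk value for matrices that are not symmetric. *)
Definition expmx (R : realType) (n : nat) (A : 'M[R]_n) : 'M[R]_n :=
  xget 0 [set E | exists U l, orthogonal_diagonalization A U l /\
                    E = U *m diag_mx (map_mx expR l) *m U^T].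

(* Measurability for the Borel sigma-algebra of the space of matrices is
   measurability of all the entries. *)
Definition random_symmetric_matrix (disp : measure_display)
    (T : measurableType disp) (R : realType) (n : nat)
    (Y : T -> 'M[R]_n) : Prop :=
  (forall i j, measurable_fun [set: T] (fun w => Y w i j)) /\
  (forall w, Y w \is symmetricmx).

(* Main.v *)
Require Import Defs.
From HB Require Import structures.
From mathcomp Require Import all_boot all_order all_algebra.
From mathcomp Require Import all_classical all_reals all_analysis.
From mathcomp Require Import (canonicals) complex.

(* This is Markov's inequality applied to [tr (exp (theta Y))]: the trace is
   the sum of the [d] numbers [exp (theta l)] with [l] an eigenvalue of [Y], so
   it is nonnegative, and at least [d exp (theta t)] where
   [lambda_min Y >= t]. Taking the probability of that event requires its
   measurability: by the spectral theorem it says that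
   [x Y x^T >= t x x^T] for every row vector [x], and by continuity rational
   vectors suffice, which makes it a countable intersection of measurable
   sets. *)

Set Implicit Arguments.
Unset Strict Implicit.
Unset Printing Implicit Defensive.

Import Order.TTheory GRing.Theory Num.Theory.
Import numFieldNormedType.Exports.

Local Open Scope classical_set_scope.
Local Open Scope ring_scope.

(** * Spectral theorem for real symmetric matrices *)

(* The complexification of [A] is Hermitian, so its eigenvalues are real. *)
Lemma symmetric_eigenvalue (R : rcfType) (n : nat) (A : 'M[R]_n) :
  (0 < n)%N -> A^T = A -> exists a, eigenvalue A a.
Proof.
move=> n_gt0 Asym; pose C : numClosedFieldType := complex.complex R.
pose f : {rmorphism R -> C} := complex.real_complex R.
pose B : 'M[C]_n := map_mx f A.
have BR : B \is a mxOver Num.real.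
  by apply/mxOverP => i j; rewrite mxE; apply/complex.complex_realP; exists (A i j).
have Bsym : B \is hermitianmx n false idfun.
  have BT : B^T = B by rewrite map_trmx Asym.
  by apply/is_hermitianmxP; rewrite expr0 scale1r BT; apply/matrixP => i j; rewrite [RHS]mxE.
have Bherm := realsym_hermsym Bsym BR.
have /orthomx_spectralP BE := hermitian_normalmx Bherm.
have /mxOverP/(_ ord0 (Ordinal n_gt0)) := hermitian_spectral_diag_real Bherm.
set l := spectral_diag B in BE *; set P := spectralmx B in BE.
move=> /complex.complex_realP [a la]; exists a.
have Pu : P \in unitmx by exact: spectral_unit.
suff : eigenvalue B (f a).
  by rewrite !eigenvalue_root_char -map_char_poly fmorph_root.
(* Since [P *m B = diag_mx l *m P], the rows of [P] are left eigenvectors of [B]; a zero row would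
   contradict the invertibility of [P]. *)
apply/eigenvalueP; exists (row (Ordinal n_gt0) P).
  rewrite BE !mulmxA -[row _ P *m _]row_mul mulmxV // row1.
  by rewrite -[_ *m diag_mx _]rowE row_diag_mx la -scalemxAl -rowE.
apply/negP => /eqP/rowP P0.
have /matrixP/(_ (Ordinal n_gt0) (Ordinal n_gt0)) := mulmxV Pu.
rewrite !mxE eqxx big1 => [/esym/eqP|k _]; first by rewrite oner_eq0.
by have := P0 k; rewrite !mxE => ->; rewrite mul0r.
Qed.

Section SquaredNorm.
Variables (R : realDomainType) (n : nat).
Implicit Types v : 'rV[R]_n.

Lemma mulmx_trE v : (v *m v^T) 0 0 = \sum_i v 0 i ^+ 2.
Proof. by rewrite mxE; apply: eq_bigr => i _; rewrite mxE expr2. Qed.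

Lemma mulmx_tr_ge0 v : 0 <= (v *m v^T) 0 0.
Proof. by rewrite mulmx_trE sumr_ge0 // => i _; exact: sqr_ge0. Qed.

Lemma mulmx_tr_eq0 v : ((v *m v^T) 0 0 == 0) = (v == 0).
Proof.
rewrite mulmx_trE psumr_eq0 => [|i _]; last exact: sqr_ge0.
apply/allP/eqP => [v0|-> i _]; last by rewrite /= mxE expr0n eqxx.
apply/rowP => i; rewrite mxE.
by have := v0 i (mem_index_enum i); rewrite /= sqrf_eq0 => /eqP.
Qed.

Lemma mulmx_tr_gt0 v : (0 < (v *m v^T) 0 0) = (v != 0).
Proof. by rewrite lt_neqAle eq_sym mulmx_tr_eq0 mulmx_tr_ge0 andbT. Qed.

End SquaredNorm.

Lemma symmetric_unit_eigenvector (R : rcfType) (n : nat) (A : 'M[R]_n) :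
  (0 < n)%N -> A^T = A ->
  exists a (v : 'rV_n), v *m A = a *: v /\ v *m v^T = 1%:M.
Proof.
move=> n_gt0 /(symmetric_eigenvalue n_gt0)[a /eigenvalueP[v vA v0]].
have : 0 < (v *m v^T) 0 0 by rewrite mulmx_tr_gt0.
have := mx11_scalar (v *m v^T); set q := (v *m v^T) 0 0 => vv q_gt0.
exists a, ((Num.sqrt q)^-1 *: v); split.
  by rewrite -scalemxAl vA !scalerA mulrC.
rewrite linearZ /= -scalemxAl -scalemxAr scalerA vv -invfM -expr2.
by rewrite sqr_sqrtr ?ltW // scale_scalar_mx mulVf // gt_eqF.
Qed.

(* For [e != v] take the Householder reflection in the hyperplane orthogonal to
   [w = e - v]; its factor [2 / |w|^2] is [(1 - s)^-1] with [s = <e, v>]. *)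
Lemma householder (R : realFieldType) (n : nat) (e v : 'rV[R]_n) :
  e *m e^T = 1%:M -> v *m v^T = 1%:M ->
  exists H : 'M[R]_n, [/\ H^T = H, H *m H = 1%:M & e *m H = v].
Proof.
move=> ee vv; have [->|ev] := eqVneq e v.
  by exists 1%:M; rewrite trmx1 !mulmx1.
pose w := e - v; pose s := (e *m v^T) 0 0.
have evE : e *m v^T = s%:M by rewrite [LHS]mx11_scalar.
have veE : v *m e^T = s%:M by rewrite -[LHS]trmxK trmx_mul trmxK evE tr_scalar_mx.
have ewE : e *m w^T = (1 - s)%:M.
  by rewrite linearB /= mulmxBr ee evE raddfB.
have wwE : w *m w^T = (2 * (1 - s))%:M.
  rewrite mulmxBl ewE linearB /= mulmxBr veE vv -!raddfB /=.
  by rewrite mulr_natl mulr2n opprB.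
(* If [s = 1], then [w] has squared norm [0], which forces [e = v]. *)
have q0 : 1 - s != 0.
  apply/eqP => s1; move/eqP: ev; apply; apply/eqP; rewrite -subr_eq0 -/w.
  by rewrite -mulmx_tr_eq0 wwE s1 mulr0 mxE mul0rn.
pose c := (1 - s)^-1.
pose H : 'M[R]_n := 1%:M - c *: (w^T *m w).
have XX : w^T *m w *m (w^T *m w) = (2 * (1 - s)) *: (w^T *m w).
  by rewrite mulmxA -[_ *m w *m _]mulmxA wwE mul_mx_scalar -scalemxAl.
exists H; split.
- by rewrite /H linearB linearZ /= trmx1 trmx_mul trmxK.
(* With [c = (1 - s)^-1], the quadratic term of the square is [2 * c *: X], which cancels the cross
   terms. *)
- have HH (X : 'M[R]_n) : X *m X = (2 * (1 - s)) *: X ->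
      (1%:M - c *: X) *m (1%:M - c *: X) = 1%:M.
    move=> XE; rewrite mulmxBl !mulmxBr !mul1mx mulmx1 -scalemxAl -scalemxAr XE.
    rewrite !scalerA -mulrA [c * (2 * _)]mulrCA mulVf // mulr1 mulr_natr mulr2n.
    by rewrite scalerDl opprB addrK subrK.
  exact: HH.
- rewrite /H mulmxBr mulmx1 -scalemxAr mulmxA ewE mul_scalar_mx scalerA.
  by rewrite mulVf // scale1r /w opprB addrC subrK.
Qed.

(* Conjugating by the reflection that exchanges the first basis vector with a
   unit eigenvector splits off a block of size one. *)
Lemma spectral_theorem (R : realType) (n : nat) (A : 'M[R]_n) :
  A^T = A -> exists U l, orthogonal_diagonalization A U l.
Proof.
elim: n A => [|n IHn] A Asym.
  by exists 1%:M, 0; split; apply/matrixP => -[].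
have [a [v [vA vv]]] := symmetric_unit_eigenvector (ltn0Sn n) Asym.
pose e : 'rV[R]_(1 + n) := row_mx 1%:M 0.
have ee : e *m e^T = 1%:M.
  by rewrite tr_row_mx mul_row_col trmx1 mulmx1 mul0mx addr0.
have [H [Hsym HH eH]] := householder ee vv.
have vH : v *m H = e by rewrite -eH -mulmxA HH mulmx1.
pose B : 'M[R]_(1 + n) := H *m A *m H.
have AE : A = H *m B *m H.
  by rewrite /B !mulmxA HH mul1mx -mulmxA HH mulmx1.
have Bsym : B^T = B by rewrite /B !trmx_mul Hsym Asym mulmxA.
(* The vector [e] goes to [v] under [H], is scaled by [a] under [A], and returns to [e] under [H].
   So the first row of [B] is [(a, 0)], and by symmetry so is its first column. *)
have eB : e *m B = row_mx a%:M 0.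
  rewrite /B !mulmxA eH vA -scalemxAl vH /e scale_row_mx scaler0.
  by rewrite scale_scalar_mx mulr1.
have : B = block_mx a%:M 0 0 (drsubmx B).
  move: eB; rewrite -{1}[B]submxK mul_row_block !mul1mx !mul0mx !addr0.
  move=> /eq_row_mx [ulB urB].
  have dlB : dlsubmx B = 0 by rewrite -Bsym -trmx_ursub urB trmx0.
  by rewrite -{1}[B]submxK ulB urB dlB.
have /IHn : (drsubmx B)^T = drsubmx B by rewrite trmx_drsub Bsym.
move: (drsubmx B) => B' [V [l [VV B'E]]] BE.
pose W : 'M[R]_(1 + n) := block_mx 1%:M 0 0 V.
have WW : W *m W^T = 1%:M.
  rewrite (@tr_block_mx _ 1 n 1 n) mulmx_block !trmx0 trmx1.
  by rewrite !(mulmx0, mul0mx, addr0, add0r, mulmx1) VV -scalar_mx_block.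
have WBW : B = W *m diag_mx (row_mx a%:M l) *m W^T.
  rewrite BE B'E (@tr_block_mx _ 1 n 1 n) diag_mx_row !mulmx_block !trmx0 trmx1.
  rewrite !(mulmx0, mul0mx, addr0, add0r, mulmx1, mul1mx).
  by congr (block_mx _ _ _ _); apply/matrixP => i j; rewrite !ord1 !mxE.
exists (H *m W), (row_mx a%:M l); split; rewrite trmx_mul Hsym.
  by rewrite mulmxA -[H *m W *m _]mulmxA WW mulmx1.
by rewrite AE WBW !mulmxA.
Qed.

(** * Eigenvalues, quadratic form and exponential of a diagonalized matrix *)

Section OrthogonalDiagonalization.
Variables (R : realType) (n : nat) (A U : 'M[R]_n) (l : 'rV[R]_n).
Hypothesis AUl : orthogonal_diagonalization A U l.

Let UtU : U^T *m U = 1%:M. Proof. by case: AUl => /mulmx1C. Qed.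

Lemma eigenvalue_diagonal i : eigenvalue A (l 0 i).
Proof.
apply/eigenvalueP; exists (row i U^T).
  rewrite AUl.2 -row_mul !mulmxA UtU mul1mx row_mul row_diag_mx -scalemxAl.
  by rewrite -rowE.
apply/eqP => /rowP U0; have /matrixP/(_ i i) := UtU.
rewrite !mxE eqxx big1 => [/esym/eqP|k _]; first by rewrite oner_eq0.
by have := U0 k; rewrite !mxE => ->; rewrite mul0r.
Qed.

Lemma eigenvalue_diagonalP a : eigenvalue A a -> exists i, a = l 0 i.
Proof.
move=> /eigenvalueP[v vA v0].
have : v *m U != 0.
  apply: contra_neq v0 => vU; rewrite -[v]mulmx1 -AUl.1.
  by rewrite mulmxA vU mul0mx.
(* In the coordinates [v *m U] the matrix acts diagonally, so [a] and [l 0 i] agree at any nonzero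
   coordinate. *)
move=> /rV0Pn[i vUi]; exists i; apply: (mulIf vUi).
have : v *m U *m diag_mx l = a *: (v *m U).
  by rewrite scalemxAl -vA AUl.2 -!mulmxA UtU mulmx1.
by move=> /rowP/(_ i); rewrite mul_mx_diag !mxE => <-; rewrite mulrC.
Qed.

Lemma quadratic_form_diagonal (x : 'rV_n) :
  (x *m A *m x^T) 0 0 = \sum_i l 0 i * (x *m U) 0 i ^+ 2.
Proof.
rewrite AUl.2 !mulmxA -[_ *m U^T *m _]mulmxA -trmx_mul mxE.
by apply: eq_bigr => i _; rewrite mul_mx_diag !mxE mulrAC mulrC expr2.
Qed.

Lemma sqnorm_diagonal (x : 'rV_n) :
  (x *m x^T) 0 0 = \sum_i (x *m U) 0 i ^+ 2.
Proof.
by rewrite -mulmx_trE trmx_mul mulmxA -[x *m U *m _]mulmxA AUl.1 mulmx1.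
Qed.

End OrthogonalDiagonalization.

Lemma mxtrace_orthogonal_conj (R : comNzRingType) (n : nat) (U B : 'M[R]_n) :
  U *m U^T = 1%:M -> \tr (U *m B *m U^T) = \tr B.
Proof. by move=> UU; rewrite mxtrace_mulC mulmxA (mulmx1C UU) mul1mx. Qed.

(** The vector [l] comes from whichever diagonalization [expmx] selected; the spectral theorem
    ensures that there is one, so that the junk value does not occur. *)
Lemma mxtrace_expmx (R : realType) (n : nat) (A : 'M[R]_n) : A^T = A ->
  exists2 l : 'rV_n, (forall i, eigenvalue A (l 0 i)) &
    \tr (expmx A) = \sum_i expR (l 0 i).
Proof.
move=> /spectral_theorem[U0 [l0 Al0]]; rewrite /expmx.
have [|U [l [Al ->]]] := @xgetPex _ 0 [set E | exists U l,
    orthogonal_diagonalization A U l /\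
    E = U *m diag_mx (map_mx expR l) *m U^T].
  by exists (U0 *m diag_mx (map_mx expR l0) *m U0^T), U0, l0.
exists l => [i|]; first exact: eigenvalue_diagonal Al i.
rewrite mxtrace_orthogonal_conj ?Al.1 // mxtrace_diag.
by apply: eq_bigr => i _; rewrite mxE.
Qed.

(** The smallest diagonal entry of a diagonalization is a least eigenvalue, so [lambda_min] is not
    the junk value. *)
Lemma lambda_minP (R : realType) (n : nat) (A : 'M[R]_n) :
  (0 < n)%N -> A^T = A ->
  eigenvalue A (lambda_min A) /\
  forall b, eigenvalue A b -> lambda_min A <= b.
Proof.
move=> n_gt0 /spectral_theorem[U [l Al]]; rewrite /lambda_min.
apply: (@xgetPex _ 0 [set a | eigenvalue A a /\ _]).
have [i _ li] := @Order.TotalTheory.arg_minP _ _ _ (Ordinal n_gt0) xpredT (l 0) isT.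
exists (l 0 i); split; first exact: eigenvalue_diagonal Al i.
by move=> b /(eigenvalue_diagonalP Al)[j ->]; exact: li.
Qed.

(** In the coordinates [x *m U] the form is a sum of squares weighted by eigenvalues, each at least
    [lambda_min A]. Conversely, test the inequality on an eigenvector for [lambda_min A]. *)
Lemma lambda_min_geP (R : realType) (n : nat) (A : 'M[R]_n) (t : R) :
  (0 < n)%N -> A^T = A ->
  t <= lambda_min A <->
  forall x : 'rV_n, t * (x *m x^T) 0 0 <= (x *m A *m x^T) 0 0.
Proof.
move=> n_gt0 Asym; have [lmA lm_le] := lambda_minP n_gt0 Asym; split.
  have [U [l Al]] := spectral_theorem Asym => t_le x.
  rewrite (quadratic_form_diagonal Al) (sqnorm_diagonal Al) mulr_sumr.
  apply: ler_sum => i _; rewrite ler_wpM2r ?sqr_ge0 //.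
  by rewrite (le_trans t_le) // lm_le //; exact: eigenvalue_diagonal Al i.
move=> At; have /eigenvalueP[v vA v0] := lmA.
have := At v; rewrite vA -scalemxAl [leRHS]mxE ler_pM2r //.
by rewrite mulmx_tr_gt0.
Qed.

(** * Measurability of the event through rational test vectors *)

Lemma ratr_seq_cvg (R : realType) (x : R) :
  exists u : nat -> rat, ratr (u k) @[k --> \oo] --> x.
Proof.
have /choice[u xu] (k : nat) : exists q : rat, `|x - ratr q| < k.+1%:R^-1.
  have B0 : ball x k.+1%:R^-1 !=set0.
    by exists x; apply: ballxx; rewrite invr_gt0.
  have [y [xy [q _ qy]]] := dense_rat B0 (ball_open x k.+1%:R^-1).
  by exists q; rewrite qy.
exists u; apply/cvgrPdist_lt => e e0.
near=> k; apply: lt_trans (xu k) _; near: k.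
exact: near_infty_natSinv_lt (PosNum e0).
Unshelve. all: by end_near. Qed.

Lemma rV_ratr_seq_cvg (R : realType) (n : nat) (x : 'rV[R]_n) :
  exists u : nat -> 'rV[rat]_n,
    forall i, ratr (u k 0 i) @[k --> \oo] --> x 0 i.
Proof.
have /choice[u xu] (i : 'I_n) := ratr_seq_cvg (x 0 i).
exists (fun k => \row_i u i k) => i.
by under eq_fun do rewrite mxE; exact: xu.
Qed.

Lemma quadratic_formE (R : pzRingType) (n : nat) (A : 'M[R]_n) (x : 'rV_n) :
  (x *m A *m x^T) 0 0 = \sum_j (\sum_i x 0 i * A i j) * x 0 j.
Proof. by rewrite mxE; apply: eq_bigr => j _; rewrite !mxE. Qed.

Lemma quadratic_form_cvg (R : realType) (n : nat) (A : 'M[R]_n)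
    (u : nat -> 'rV[R]_n) (x : 'rV[R]_n) :
  (forall i, u k 0 i @[k --> \oo] --> x 0 i) ->
  (u k *m A *m (u k)^T) 0 0 @[k --> \oo] --> (x *m A *m x^T) 0 0.
Proof.
move=> ux; rewrite quadratic_formE; under eq_fun do rewrite quadratic_formE.
apply: cvg_big => [|j _]; first exact: add_continuous.
apply: cvgM => //; apply: cvg_big => [|i _]; first exact: add_continuous.
by apply: cvgM => //; exact: cvg_cst.
Qed.

Lemma lambda_min_ge_ratP (R : realType) (n : nat) (A : 'M[R]_n) (t : R) :
  (0 < n)%N -> A^T = A ->
  t <= lambda_min A <->
  forall q : 'rV[rat]_n, let x := map_mx ratr q in
    t * (x *m x^T) 0 0 <= (x *m A *m x^T) 0 0.
Proof.
move=> n_gt0 Asym; rewrite (lambda_min_geP _ n_gt0 Asym).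
split=> [At q|At x]; first exact: At.
have [u ux] := rV_ratr_seq_cvg x.
pose v k : 'rV[R]_n := map_mx ratr (u k).
have vx i : v k 0 i @[k --> \oo] --> x 0 i.
  by under eq_fun do rewrite mxE; exact: ux.
(* The instance at [1%:M] gives the convergence of the squared norms. *)
have vA := quadratic_form_cvg (A := A) vx; have := quadratic_form_cvg (A := 1%:M) vx.
rewrite mulmx1; under eq_fun do rewrite mulmx1.
move=> v1.
have tv1 : t * (v k *m (v k)^T) 0 0 @[k --> \oo] --> t * (x *m x^T) 0 0.
  by apply: cvgM => //; exact: cvg_cst.
by apply: ler_cvg_to tv1 vA _; apply: nearW => k; exact: At.
Qed.

(** Indexing by codes in [nat] turns this into a sequential intersection; numbers that code no
    element contribute the whole space. *)
Lemma measurable_forall_countable (disp : measure_display)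
    (T : measurableType disp) (I : countType) (F : I -> set T) :
  (forall i, measurable (F i)) -> measurable [set w | forall i, F i w].
Proof.
move=> mF.
have -> : [set w | forall i, F i w] =
    \bigcap_k (if unpickle k is Some i then F i else setT).
  apply/seteqP; split=> w /= Fw => [k _|i].
    by case: unpickle => // i; exact: Fw.
  by have := Fw (pickle i) Logic.I; rewrite pickleK.
by apply: bigcapT_measurable => k; case: unpickle.
Qed.

Lemma measurable_lambda_min_ge (R : realType) (disp : measure_display)
    (T : measurableType disp) (n : nat) (Y : T -> 'M[R]_n) (t : R) :
  (0 < n)%N -> (forall i j, measurable_fun [set: T] (fun w => Y w i j)) ->
  (forall w, (Y w)^T = Y w) -> measurable [set w | t <= lambda_min (Y w)].
Proof.
move=> n_gt0 mY Ysym.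
rewrite (_ : [set _ | _] = [set w | forall q : 'rV[rat]_n,
    let x := map_mx ratr q in
    t * (x *m x^T) 0 0 <= (x *m Y w *m x^T) 0 0]); last first.
  by apply/seteqP; split=> w /=; rewrite lambda_min_ge_ratP.
apply: measurable_forall_countable => q /=.
rewrite -[X in measurable X]setTI; apply: measurable_fun_le => //.
under eq_fun do rewrite quadratic_formE.
apply: measurable_sum => j; apply: measurable_realfun.measurable_funM => //.
by apply: measurable_sum => i; apply: measurable_realfun.measurable_funM.
Qed.

(** * Markov's inequality and the trace bound *)

(* Unlike [markov], this needs no measurability of [f]: the integral of a
   nonnegative function is a supremum over the simple functions below it. *)
Lemma ge0_integral_ge_measure (disp : measure_display)
    (T : measurableType disp) (R : realType)
    (mu : {measure set T -> \bar R}) (A : set T) (f : T -> \bar R) (c : R) :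
  measurable A -> 0 <= c -> (forall w, (0 <= f w)%E) ->
  (forall w, A w -> (c%:E <= f w)%E) ->
  (c%:E * mu A <= \int[mu]_w f w)%E.
Proof.
move=> mA c0 f0 Af; rewrite ge0_integralTE //.
(* The simple function is [c] times the indicator of [A]: below [f] on [A] by hypothesis, and zero
   elsewhere. *)
apply: ereal_sup_ubound; exists (scale_nnsfun (indic_nnsfun R mA) c0) => /=.
  move=> w; rewrite measurable_realfun.mindicE; have [/set_mem Aw|_] := boolP (w \in A).
    by rewrite mulr1; exact: Af.
  by rewrite mulr0; exact: f0.
by rewrite sintegralrM /= sintegral_indic.
Qed.

Theorem theorem2p8 (R : realType) (disp : measure_display)
    (T : measurableType disp) (P : probability T R)
    (d : nat) (hd : (0 < d)%N) (Y : T -> 'M[R]_d)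
    (hY : random_symmetric_matrix Y) (t : R) :
  (P [set w | (t <= lambda_min (Y w))%R] <=
    (d%:R^-1)%:E *
    ereal_inf [set (expR (- theta * t))%:E *
                   'E_P[fun w => \tr (expmx (theta *: Y w))]
              | theta in [set x : R | (0 < x)%R]])%E.
Proof.
have [mY symY] := hY.
have Ysym w : (Y w)^T = Y w.
  have /is_hermitianmxP := symY w.
  by rewrite expr0 scale1r map_mx_id // => /esym.
(* Moving both factors to the left leaves, for each [theta], a Markov bound with constant
   [expR (theta * t) * d]. *)
rewrite lee_pdivlMl ?ltr0n //; apply: le_ereal_inf_tmp => _ /= [theta th0 <-].
rewrite mulNr expRN lee_pdivlMl ?expR_gt0 // muleA -EFinM unlock.
have tYsym w : (theta *: Y w)^T = theta *: Y w by rewrite linearZ /= Ysym.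
apply: ge0_integral_ge_measure.
- exact: measurable_lambda_min_ge.
- by rewrite mulr_ge0 ?expR_ge0.
- move=> w; have [l _ ->] := mxtrace_expmx (tYsym w).
  by rewrite lee_fin sumr_ge0 // => i _; exact: expR_ge0.
move=> w /= tY; have [l Yl ->] := mxtrace_expmx (tYsym w).
(* The constant is written as a sum of [d] copies of [expR (theta * t)], to be compared with the
   trace term by term. *)
rewrite lee_fin mulr_natr -[X in _ *+ X]card_ord -sumr_const.
apply: ler_sum => i _; rewrite ler_expR.
have [_ lmin] := lambda_minP hd (Ysym w).
have /eigenvalueP[v vl v0] := Yl i.
(* Dividing an eigenvalue of [theta *: Y w] by [theta] gives an eigenvalue of [Y w], which is at
   least [lambda_min (Y w)]. *)
have -> : l 0 i = theta * (theta^-1 * l 0 i) by rewrite mulVKf ?gt_eqF.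
rewrite ler_pM2l // (le_trans tY) // lmin //; apply/eigenvalueP; exists v => //.
by rewrite -scalerA -vl -scalemxAr scalerA mulVf ?scale1r // gt_eqF.
Qed.
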